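(* Let $n\ge2$, $k\ge0$, $\nu_1,\ldots,\nu_n>0$. The map \[ CK_n^{BG}(p)=\Gamma(2\nu_n)\sum_{j=0}^k\frac{\big(-x_nL_-^{[n-1]}\big)^j}{j!\,\Gamma(j+2\nu_n)}\,p,\qquad p\in\mathcal{P}_k(\mathbb{R}^{n-1}), \] is an isomorphism of vector spaces from $\mathcal{P}_k(\mathbb{R}^{n-1})$ onto $\mathcal{H}^{BG}_k(\mathbb{R}^n)$.
   Context: $\mathcal{P}_k(\mathbb{R}^m)$ is the space of real homogeneous polynomials of degree $k$ in $x_1,\ldots,x_m$. For $m\le n$, $L_-^{[m]}=\sum_{j=1}^m\big(x_j\partial_{x_j}^2+2\nu_j\partial_{x_j}\big)$. $\mathcal{H}^{BG}_k(\mathbb{R}^n)=\mathcal{P}_k(\mathbb{R}^n)\cap\ker L_-^{[n]}$. *)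

(* Defs.v *)
From HB Require Import structures.
From mathcomp Require Import all_boot all_order all_algebra.
From mathcomp Require Import mpoly.
From mathcomp Require Import all_classical all_reals all_analysis.

Set Implicit Arguments.
Unset Strict Implicit.
Unset Printing Implicit Defensive.

Import Order.TTheory GRing.Theory Num.Theory.
Local Open Scope ring_scope.

Definition Gamma (R : realType) (s : R) : R :=
  fine (\int[@lebesgue_measure R]_(t in `]0%R, +oo[%classic)
          ((powR t (s - 1)) * expR (- t))%:E)%E.

Definition Lminus (R : comNzRingType) (n m : nat) (nu : 'I_n -> R)
    (p : {mpoly R[n]}) : {mpoly R[n]} :=
  \sum_(j < n | (j < m)%N)
     ('X_j * p^`M(j, 2) + (2 * nu j) *: p^`M(j)).

Definition HBG (R : comNzRingType) (n k : nat) (nu : 'I_n -> R)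
    (q : {mpoly R[n]}) : Prop :=
  q \is k.-homog /\ Lminus n nu q = 0.

(* CK_n^BG for n = m.+1: polynomials in m = n-1 variables x_1..x_{n-1}
   are embedded into n variables by mwiden; x_n is 'X_ord_max and
   nu_n is nu ord_max. *)
Definition CK (R : realType) (m k : nat) (nu : 'I_m.+1 -> R)
    (p : {mpoly R[m]}) : {mpoly R[m.+1]} :=
  Gamma (2 * nu ord_max) *:
    \sum_(j < k.+1)
      ((j`!%:R * Gamma (j%:R + 2 * nu ord_max))^-1 *:
         iter j (fun q => - ('X_ord_max * Lminus m nu q)) (mwiden p)).

(* Main.v *)
Require Import Defs.
From HB Require Import structures.
From mathcomp Require Import all_boot all_order all_algebra.
From mathcomp Require Import mpoly.
From mathcomp Require Import all_classical all_reals all_analysis.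
From mathcomp Require Import measurable_realfun ring lra.
Import Order.TTheory GRing.Theory Num.Theory.
Import numFieldNormedType.Exports.
Local Open Scope ring_scope.

(* Split L^[n] = A + B with A = L^[n-1] and B = x_n d_n^2 + 2 nu_n d_n.  The
   coefficients c_j = Gamma(2 nu_n) / (j! Gamma(j + 2 nu_n)) satisfy
   c_(j+1) (j+1) (j + 2 nu_n) = c_j, so B sends the (j+1)-st term of CK p to minus
   the image under A of the j-th one; the sum L^[n] (CK p) telescopes to its last
   term, which contains A^(k+1) p = 0.  Conversely, an element of ker L^[n] is
   determined by its restriction to x_n = 0, because L^[n] q = 0 computes the
   coefficients of x_n^(d+1) from those of x_n^d; and CK p restricts to p. *)

Set Implicit Arguments.
Unset Strict Implicit.
Unset Printing Implicit Defensive.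

(** * The operator L^[k] on coefficients *)

Section Lminus_theory.
Context {R : comNzRingType} {n : nat}.
Implicit Types (nu : 'I_n -> R) (p q : {mpoly R[n]}) (m : 'X_{1..n}).

Lemma mcoeffXU_mul (i : 'I_n) p m :
  ('X_i * p)@_m = if m i == 0%N then 0 else p@_(m - U_(i)).
Proof.
case: eqP => [mi0|/eqP mi0]; last first.
  by rewrite mulrC -{1}(submK (m := U_(i)) (m' := m)) ?lep1mP// addmC mcoeffMX.
apply/memN_msupp_eq0/negP => /msuppM_le /allpairsP[[m1 m2] /=].
rewrite msuppX inE => -[/eqP -> _ mE].
by move/(congr1 (fun m : 'X_{1..n} => m i)): mE; rewrite mnmDE mnm1E eqxx mi0.
Qed.

(** The operator x_j d_j^2 + 2 nu_j d_j sends x_j^(a+1) to (a+1)(a + 2 nu_j) x_j^a. Linearity, the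
    drop in degree and the uniqueness argument are all read off from this formula. *)
Lemma mcoeff_Lminus (k : nat) nu p m :
  (Lminus k nu p)@_m =
  \sum_(j < n | (j < k)%N) (m j).+1%:R * ((m j)%:R + 2 * nu j) * p@_(m + U_(j)).
Proof.
rewrite /Lminus raddf_sum/=; apply: eq_bigr => j _.
rewrite mcoeffD mcoeffZ mcoeffXU_mul mderivn_iter/= !mcoeff_mderiv.
case: eqP => [->|/eqP mj0].
  by rewrite !add0r mulr_natl mul1r.
rewrite mnmBE mnm1E eqxx subn1 prednK ?lt0n// submK ?lep1mP//.
rewrite -(mulr_natr _ (m j)) -(mulr_natr (p@_ _)); set c := p@_ _; set b := (m j).+1%:R.
set a := (m j)%:R; ring.
Qed.

Lemma Lminus_linear (k : nat) nu : linear (Lminus k nu).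
Proof.
move=> a p q; apply/mpolyP => m.
rewrite mcoeffD mcoeffZ !mcoeff_Lminus mulr_sumr -big_split/=.
by apply: eq_bigr => j _; rewrite mcoeffD mcoeffZ; ring.
Qed.

HB.instance Definition _ (k : nat) nu :=
  GRing.isLinear.Build R {mpoly R[n]} {mpoly R[n]} *:%R (Lminus k nu)
    (Lminus_linear k nu).

Lemma dhomog_mcoeff_eq0 d p : p \is d.-homog ->
  forall m, mdeg m != d -> p@_m = 0.
Proof. by move=> hp m; exact: dhomog_nemf_coeff. Qed.

Lemma mcoeff_eq0_dhomog d p : (forall m, mdeg m != d -> p@_m = 0) -> p \is d.-homog.
Proof.
move=> h; apply/dhomogP => m; rewrite mcoeff_msupp => pm.
by apply/eqP; apply: contraNT pm => /h ->.
Qed.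

Lemma Lminus_dhomog (k d : nat) nu p :
  p \is d.+1.-homog -> Lminus k nu p \is d.-homog.
Proof.
move=> hp; apply/mcoeff_eq0_dhomog => m md; rewrite mcoeff_Lminus big1// => j _.
by rewrite (dhomog_mcoeff_eq0 hp) ?mulr0// mdegD mdeg1 addn1 eqSS.
Qed.

Lemma Lminus_dhomog0 (k : nat) nu p : p \is 0.-homog -> Lminus k nu p = 0.
Proof.
move=> hp; apply/mpolyP => m; rewrite mcoeff_Lminus mcoeff0 big1// => j _.
by rewrite (dhomog_mcoeff_eq0 hp) ?mulr0// mdegD mdeg1 addn1.
Qed.

End Lminus_theory.

(** * Splitting off the last variable x *)

Section Lminus_last_variable.
Context {R : comNzRingType} {n : nat} (nu : 'I_n.+1 -> R).
Implicit Types (p q : {mpoly R[n.+1]}).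
Local Notation x := ('X_ord_max : {mpoly R[n.+1]}).
Local Notation A := (Lminus n nu).

(** This is the summand B of the splitting A + B. *)
Definition last_op p := x * p^`M(ord_max, 2) + (2 * nu ord_max) *: p^`M(ord_max).

Lemma Lminus_recr p : Lminus n.+1 nu p = A p + last_op p.
Proof.
rewrite /Lminus big_mkcond big_ord_recr/= ltnSn; congr (_ + _).
rewrite [RHS]big_mkcond big_ord_recr/= ltnn addr0.
by apply: eq_bigr => i _ /=; rewrite ltn_ord ltnS ltnW ?ltn_ord.
Qed.

(** [A] differentiates only in the variables before the last, so x behaves as a scalar for it. *)
Lemma Lminus_mul_last p : A (x * p) = x * A p.
Proof.
rewrite /Lminus mulr_sumr; apply: eq_bigr => j jn.
have dx q : (x * q)^`M(j) = x * q^`M(j).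
  rewrite mderivM mderivX mnm1E; case: eqP => [jE|_]; last by rewrite scale0r mul0r add0r.
  by move: jn; rewrite -jE/= ltnn.
rewrite !mderivn_iter/= !dx -!mul_mpolyC; ring.
Qed.

Lemma mderiv_last_Lminus p : (A p)^`M(ord_max) = A p^`M(ord_max).
Proof.
apply/mpolyP => m; rewrite mcoeff_mderiv !mcoeff_Lminus -sumrMnl.
apply: eq_bigr => j jn; rewrite mcoeff_mderiv mnmDE.
have mj : (U_(ord_max) : 'X_{1..n.+1})%MM j = 0%N.
  by rewrite mnm1E; case: eqP jn => // <-; rewrite ltnn.
have jm : (U_(j) : 'X_{1..n.+1})%MM ord_max = 0%N.
  by rewrite mnm1E; case: eqP jn => // ->; rewrite ltnn.
by rewrite mj addn0 mnmDE jm addn0 mulrnAr -!addmA [(U_(ord_max) + _)%MM]addmC.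
Qed.

Lemma Lminus_mul_lastX i p : A (x ^+ i * p) = x ^+ i * A p.
Proof.
elim: i p => [|i IH] p; rewrite ?expr0 ?mul1r//.
by rewrite exprS -mulrA Lminus_mul_last IH mulrA.
Qed.

(** Since x commutes with [A], all its powers move to the left. When p is free of x, this separates
    the power of x from a factor free of x. *)
Lemma iter_CK_step j p :
  iter j (fun q => - (x * A q)) p = (-1) ^+ j *: (x ^+ j * iter j A p).
Proof.
elim: j => [|j IH]; first by rewrite !expr0 mul1r scale1r.
rewrite iterS IH linearZ/= Lminus_mul_lastX exprS mulN1r scaleNr -scalerAr.
by rewrite exprS mulrA.
Qed.

Lemma mderiv_last_iter_Lminus j p :
  p^`M(ord_max) = 0 -> (iter j A p)^`M(ord_max) = 0.
Proof.
by move=> p0; elim: j => //= j IH; rewrite mderiv_last_Lminus IH linear0.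
Qed.

(** With p constant in x, only the power of x is differentiated, and (j+1) j + 2 nu_n (j+1) factors
    as stated. *)
Lemma last_op_XnM j p : p^`M(ord_max) = 0 ->
  last_op (x ^+ j.+1 * p) = (j.+1%:R * (j%:R + 2 * nu ord_max)) *: (x ^+ j * p).
Proof.
move=> p0.
have dX i : (x ^+ i)^`M(ord_max) = i%:R *: x ^+ i.-1.
  elim: i => [|i IH]; first by rewrite expr0 -mpolyC1 mderivC scale0r.
  have U0 : (U_(ord_max) - U_(ord_max) = 0 :> 'X_{1..n.+1})%MM.
    by apply/mnmP => l; rewrite mnmBE subnn mnm0E.
  rewrite exprS mderivM mderivX mnm1E eqxx scale1r U0 mpolyX0 mul1r IH.
  case: i {IH} => [|i]; first by rewrite scale0r mulr0 addr0 scale1r.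
  by rewrite -scalerAr -exprS -[i.+2%:R]natr1 scalerDl scale1r addrC.
have dXp i : (x ^+ i * p)^`M(ord_max) = i%:R *: (x ^+ i.-1 * p).
  by rewrite mderivM p0 mulr0 addr0 dX -scalerAl.
rewrite /last_op mderivn_iter/= !dXp mderivZ dXp/=.
(* The exponent [j.-1] of the second derivative is truncated at j = 0, where x * x ^+ j.-1 is not x
   ^+ j; there the coefficient is zero. *)
case: j => [|j] /=; first by rewrite expr0 !scale0r scaler0 mulr0 !add0r scalerA mulrC.
rewrite -!scalerAr mulrA -exprS !scalerA -scalerDl; congr (_ *: _); ring.
Qed.

End Lminus_last_variable.

(** * The series for any coefficients obeying the two-term recurrence *)

Section CK_series.
Context {R : comNzRingType} {n : nat} (nu : 'I_n.+1 -> R) (c : nat -> R).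
Hypothesis c_rec : forall j, c j.+1 * (j.+1%:R * (j%:R + 2 * nu ord_max)) = c j.
Implicit Types (p q : {mpoly R[n.+1]}).
Local Notation x := ('X_ord_max : {mpoly R[n.+1]}).
Local Notation A := (Lminus n nu).

Lemma last_op_linear : linear (last_op nu).
Proof.
move=> a p q; rewrite /last_op !mderivn_iter/= !linearP/= mulrDr -scalerAr.
by rewrite scalerDr !scalerA mulrC -scalerA addrACA -scalerDr.
Qed.

HB.instance Definition _ :=
  GRing.isLinear.Build R {mpoly R[n.+1]} {mpoly R[n.+1]} *:%R (last_op nu)
    last_op_linear.

Lemma Lminus_CK_series k p : p^`M(ord_max) = 0 -> iter k.+1 A p = 0 ->
  Lminus n.+1 nu (\sum_(j < k.+1) c j *: iter j (fun q => - (x * A q)) p) = 0.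
Proof.
move=> p0 Akp; under eq_bigr do rewrite iter_CK_step.
(* The sum of [A]-images loses its last term, zero by [Akp], and the sum of [last_op]-images its
   first, zero by [p0]. The remaining terms cancel in pairs: [A] of term i against [last_op] of term
   i+1. *)
rewrite Lminus_recr !linear_sum/= big_ord_recr/= [X in _ + X]big_ord_recl/=.
have AZ a q : A (a *: q) = a *: A q by exact: linearZ.
have lZ a q : last_op nu (a *: q) = a *: last_op nu q by exact: linearZ.
rewrite AZ AZ !lZ Lminus_mul_lastX -iterS Akp mulr0 !scaler0 addr0.
have -> : last_op nu (x ^+ 0 * p) = 0.
  by rewrite mul1r /last_op mderivn_iter/= p0 linear0 mulr0 scaler0 addr0.
rewrite !scaler0 add0r -big_split/= big1// => i _.
rewrite !AZ !lZ /bump/= !add1n add0n Lminus_mul_lastX -iterS.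
rewrite last_op_XnM ?mderiv_last_iter_Lminus// -c_rec exprS !scalerA -scalerDl.
by rewrite [X in X *: _](_ : _ = 0) ?scale0r//; ring.
Qed.

Lemma dhomog_CK_step k p : p \is k.-homog -> - (x * A p) \is k.-homog.
Proof.
case: k => [|k] hp; first by rewrite Lminus_dhomog0// mulr0 oppr0 dhomog0.
rewrite rpredN; apply: (dhomogM (d := 1)); last exact: Lminus_dhomog.
by rewrite dhomogX/= mdeg1.
Qed.

Lemma dhomog_CK_series k N p : p \is k.-homog ->
  \sum_(j < N) c j *: iter j (fun q => - (x * A q)) p \is k.-homog.
Proof.
move=> hp; apply: rpred_sum => j _; apply: rpredZ.
by elim: (nat_of_ord j) => //= i; exact: dhomog_CK_step.
Qed.

(** Every term with j > 0 is divisible by x, so only the term j = 0 survives at x = 0. *)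
Lemma mcoeff_CK_series N p (m : 'X_{1..n.+1}) : m ord_max = 0%N ->
  (\sum_(j < N.+1) c j *: iter j (fun q => - (x * A q)) p)@_m = c 0%N * p@_m.
Proof.
move=> m0; rewrite raddf_sum/= big_ord_recl/= mcoeffZ big1 ?addr0// => i _.
by rewrite mcoeffZ mcoeffN mcoeffXU_mul m0 oppr0 mulr0.
Qed.

End CK_series.

(** Each application lowers the degree by one, and constants are killed. This disposes of the last
    term of the telescoping sum. *)
Lemma iter_Lminus_dhomog (R : comNzRingType) (n k l : nat) (nu : 'I_n -> R) p :
  p \is k.-homog -> iter k.+1 (Lminus l nu) p = 0.
Proof.
elim: k p => [|k IH] p hp; first by rewrite /= Lminus_dhomog0.
by rewrite iterSr IH//; exact: Lminus_dhomog.
Qed.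

(** * Embedding into one more variable, and restriction to x = 0 *)

Section Widen.
Context {R : comNzRingType} {n : nat}.
Implicit Types (p : {mpoly R[n]}) (m : 'X_{1..n.+1}).

Lemma mnmwiden_narrow m : m ord_max = 0%N ->
  m = mnmwiden [multinom m (widen_ord (leqnSn n) i) | i < n].
Proof.
move=> m0; apply/mnmP => i.
case: (unliftP ord_max i) => [j ->|->]; last by rewrite mnmwiden_ordmax m0.
have -> : lift ord_max j = widen_ord (leqnSn n) j.
  by apply: val_inj; exact: (lift_max j).
by rewrite mnmwiden_widen mnmE.
Qed.

Lemma mcoeff_mwiden_eq0 p m : m ord_max != 0%N -> (mwiden p)@_m = 0.
Proof.
move=> m0; rewrite (mwidenE (leqnn _)) raddf_sum/= big1// => m' _.
rewrite mcoeffZ mcoeffX; case: eqP => [mE|_]; last by rewrite mulr0.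
by rewrite -mE mnmwiden_ordmax in m0.
Qed.

Lemma mderiv_mwiden p : (mwiden p)^`M(ord_max) = 0.
Proof.
apply/mpolyP => m; rewrite mcoeff_mderiv mcoeff_mwiden_eq0 ?mul0rn ?mcoeff0//.
by rewrite mnmDE mnm1E eqxx addn1.
Qed.

Lemma mdeg_mnmwiden (m : 'X_{1..n}) : mdeg (mnmwiden m) = mdeg m.
Proof.
rewrite !mdegE big_ord_recr/= mnmwiden_ordmax addn0.
by apply: eq_bigr => i _; rewrite mnmwiden_widen.
Qed.

Lemma dhomog_mwiden k p : p \is k.-homog -> mwiden p \is k.-homog.
Proof.
move=> hp; apply: mcoeff_eq0_dhomog => m mk.
have [m0|m0] := eqVneq (m ord_max) 0%N; last exact: mcoeff_mwiden_eq0.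
rewrite (mnmwiden_narrow m0) mwiden_mnmwiden (dhomog_mcoeff_eq0 hp)//.
by rewrite -mdeg_mnmwiden -mnmwiden_narrow.
Qed.

(** The witness is q at x = 0, assembled from the coefficients of q at monomials free of x. *)
Lemma dhomog_restrict k (q : {mpoly R[n.+1]}) : q \is k.-homog ->
  exists2 p, p \is k.-homog & forall m : 'X_{1..n}, p@_m = q@_(mnmwiden m).
Proof.
(* The bound [k.+1] on the degree keeps the sum finite and loses nothing, since q is homogeneous of
   degree k. *)
move=> hq; pose p : {mpoly R[n]} :=
  \sum_(m : 'X_{1..n < k.+1}) q@_(mnmwiden m) *: 'X_[m].
have pE (m : 'X_{1..n}) : p@_m = q@_(mnmwiden m).
  have [mk|mk] := ltnP (mdeg m) k.+1.
    exact: (mcoeff_mpoly (fun m : 'X_{1..n} => q@_(mnmwiden m))).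
  rewrite (dhomog_mcoeff_eq0 hq) ?mdeg_mnmwiden ?gtn_eqF//.
  rewrite raddf_sum/= big1// => m' _; rewrite mcoeffZ mcoeffX.
  case: eqP => [mE|]; last by rewrite mulr0.
  by have := bmdeg m'; rewrite mE ltnNge mk.
exists p => //; apply: mcoeff_eq0_dhomog => m mk.
by rewrite pE (dhomog_mcoeff_eq0 hq)// mdeg_mnmwiden.
Qed.

End Widen.

(** If m has exponent d+1 in x, the coefficient of the image of q at m / x is (d+1)(d + 2 nu_n) q_m
    plus multiples of coefficients of q with exponent d in x. The factor is nonzero because nu_n >
    0, so induction on d applies. *)
Lemma Lminus_ker_eq0 (R : numDomainType) (n : nat) (nu : 'I_n.+1 -> R)
    (q : {mpoly R[n.+1]}) : 0 < nu ord_max -> Lminus n.+1 nu q = 0 ->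
  (forall m : 'X_{1..n.+1}, m ord_max = 0%N -> q@_m = 0) -> q = 0.
Proof.
move=> nu0 Lq q0; apply/mpolyP => m; rewrite mcoeff0.
(* The monomial stays general in the induction on its exponent in x, because the hypothesis is
   needed at other monomials, [m' + U_(j)]. *)
elim: {m}(m ord_max) {-2}m (erefl (m ord_max)) => [|d IH] m md; first exact: q0.
have Um : (U_(ord_max) <= m)%MM by rewrite lep1mP md.
pose m' := (m - U_(ord_max))%MM.
have m'd : m' ord_max = d by rewrite mnmBE mnm1E eqxx md subn1.
have := congr1 (mcoeff m') Lq.
rewrite mcoeff0 mcoeff_Lminus big_mkcond big_ord_recr/= ltnSn big1 => [|j _].
  rewrite add0r m'd submK// => /eqP; rewrite !mulf_eq0 pnatr_eq0/= gt_eqF/= => [/eqP//|].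
  by rewrite ltr_wpDl// mulr_gt0.
rewrite ltnS ltnW ?ltn_ord// IH ?mulr0// mnmDE m'd mnm1E.
by case: eqP => [/(congr1 val)/= jn|]; [move: (ltn_ord j); rewrite jn ltnn|rewrite addn0].
Qed.

(** * The Gamma function *)

Section GammaFunction.
Local Open Scope classical_set_scope.
Local Open Scope ring_scope.
Context {R : realType}.
Implicit Types s t : R.
Local Notation mu := (@lebesgue_measure R).

Definition gamma_integrand s t : R := powR t (s - 1) * expR (- t).

(** [Gamma] is [fine] of this value, and [fine] sends infinity to 0. Staying in the extended reals
    allows the functional equation to come before finiteness. *)
Definition gamma_integral s : \bar R :=
  (\int[mu]_(t in `]0%R, +oo[) (gamma_integrand s t)%:E)%E.

Lemma gamma_integrand_ge0 s t : 0 <= gamma_integrand s t.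
Proof. by rewrite mulr_ge0 ?powR_ge0 ?expR_ge0. Qed.

Lemma measurable_gamma_integrand s (D : set R) :
  measurable_fun D (gamma_integrand s).
Proof.
apply: measurable_funTS; apply: measurable_funM => //.
by apply: measurableT_comp => //; exact: measurable_oppr.
Qed.

Lemma powR_le_expR_half s : exists2 C : R, 0 <= C &
  forall t, 1 <= t -> powR t s <= C * expR (t / 2).
Proof.
pose n := (Num.truncn s).+1.
have sn : s <= n%:R by apply: ltW; exact: truncnS_gt.
(* The constant comes from the single term (t/2)^n / n! of the exponential series at t/2, with n >=
   s. *)
exists (2 ^+ n * n`!%:R); first by rewrite mulr_ge0// exprn_ge0.
move=> t t1; apply: (le_trans (ler_powR t1 sn)).
have t0 : 0 <= t by rewrite (le_trans _ t1).
rewrite powR_mulrn//.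
have h : (t / 2) ^+ n / n`!%:R <= expR (t / 2).
  have := expR_ge1Dxn (Num.truncn s) (divr_ge0 t0 (ler0n _ 2)).
  by apply: le_trans; rewrite lerDr.
rewrite ler_pdivrMr ?ltr0n ?fact_gt0// expr_div_n ler_pdivrMr ?exprn_gt0// in h.
by apply: le_trans h _; rewrite le_eqVlt -[X in X == _]mulrA [X in X == _]mulrC
  [X in X * _ == _]mulrC eqxx.
Qed.

(** This is the boundary term at infinity in the integration by parts; it is at most C exp(- t/2) at
    t = n+1. *)
Lemma cvg_powR_mul_expRN s :
  powR n.+1%:R s * expR (- n.+1%:R) @[n --> \oo] --> (0 : R).
Proof.
have [C C0 hC] := powR_le_expR_half s.
apply: (@squeeze_cvgr _ _ _ _ (fun=> 0) (fun n => C * expR (- (2^-1 * n.+1%:R)))).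
- apply: nearW => n; rewrite mulr_ge0 ?powR_ge0 ?expR_ge0//=.
  have := ler_wpM2r (expR_ge0 (- n.+1%:R)) (hC n.+1%:R _).
  rewrite ler1n => /(_ isT) /le_trans; apply; rewrite -mulrA -expRD.
  by apply/ler_wpM2l => //; rewrite ler_expR; lra.
- exact: cvg_cst.
- rewrite -[X in _ --> X](mulr0 C); apply: cvgMr.
  apply: (@cvg_comp _ _ _ (fun n : nat => n.+1%:R) (fun x : R => expR (- (2^-1 * x)))
    _ (pinfty_nbhs R)).
    by have := @cvgr_idn R; rewrite -(cvg_shiftS (fun n => n%:R : R)).
  apply: (@cvg_comp _ _ _ (fun x : R => 2^-1 * x) (fun x : R => expR (- x))
    _ (pinfty_nbhs R)); last exact: cvgr_expR.
  exact: gt0_cvgMry.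
Qed.

(** This is the boundary term at 0: the exponential is at most 1, and t^s tends to 0 because s >
    0. *)
Lemma cvg_powR_inv_mul_expRN s : 0 < s ->
  powR n.+1%:R^-1 s * expR (- n.+1%:R^-1) @[n --> \oo] --> (0 : R).
Proof.
move=> s0.
have hp : (n.+1%:R^-1 : R) `^ s @[n --> \oo] --> (0 : R).
  have /cvg_at_rightP := powR_cvg0 s0; apply; split=> [n|].
    by rewrite invr_gt0.
  exact: cvg_harmonic.
apply: (@squeeze_cvgr _ _ _ _ (fun=> 0) (fun n => powR n.+1%:R^-1 s)) => //.
- apply: nearW => n; rewrite mulr_ge0 ?powR_ge0 ?expR_ge0//=.
  by rewrite ler_piMr ?powR_ge0// expR_le1 oppr_le0 invr_ge0.
- exact: cvg_cst.
Qed.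

Lemma derivable_gamma_integrand s t : 0 < t -> derivable (gamma_integrand s) t 1.
Proof.
move=> t0; apply: derivableM; first by apply: derivable_powR; rewrite in_itv/= t0.
exact: ex_derive.
Qed.

(** The factors are t^s and the primitive - exp(- t) of exp(- t); a > 0 keeps the interval inside
    the region where t^s is differentiable. *)
Lemma gamma_integrand_by_parts s (a b : R) : 0 < a -> a < b ->
  (\int[mu]_(t in `[a, b]) (gamma_integrand (s + 1) t)%:E =
   (- (powR b s * expR (- b)) + powR a s * expR (- a))%:E +
   s%:E * \int[mu]_(t in `[a, b]) (gamma_integrand s t)%:E)%E.
Proof.
move=> a0 ab.
have ge_a x : x \in `[a, b] -> 0 < x.
  by rewrite in_itv/= => /andP[ax _]; exact: lt_le_trans ax.
have gt_a x : x \in `]a, b[ -> 0 < x.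
  by rewrite in_itv/= => /andP[ax _]; exact: lt_trans ax.
have LR (F : R -> R) : (forall x, 0 < x -> derivable F x 1) ->
    derivable_oo_LRcontinuous F a b.
  move=> dF; split.
  - by move=> x /gt_a; exact: dF.
  - apply: cvg_at_right_filter; apply: differentiable_continuous.
    by apply/derivable1_diffP; exact: dF.
  - apply: cvg_at_left_filter; apply: differentiable_continuous.
    by apply/derivable1_diffP; apply: dF; exact: lt_trans ab.
have dpow (r x : R) : 0 < x -> derivable ((@powR R) ^~ r) x 1.
  by move=> x0; apply: derivable_powR; rewrite in_itv/= x0.
have dexp (x : R) : derivable (fun t : R => - expR (- t)) x 1 by exact: ex_derive.
under eq_integral do rewrite /gamma_integrand addrK.
rewrite (@integration_by_parts R ((@powR R) ^~ s) (fun t => - expR (- t))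
   (fun t => s * powR t (s - 1)) (fun t => expR (- t)))//.
- congr (_ + _)%E; first by congr EFin; ring.
  transitivity (- ((- s)%:E * \int[mu]_(t in `[a, b]) (gamma_integrand s t)%:E))%E.
    rewrite -integralZl//=.
      congr (- _)%E; apply: eq_integral => t _.
      by rewrite -EFinM /gamma_integrand; congr EFin; ring.
    apply: continuous_compact_integrable; first exact: segment_compact.
    by apply: derivable_within_continuous => x /ge_a; exact: derivable_gamma_integrand.
  by rewrite EFinN mulNe oppeK.
- apply: derivable_within_continuous => x /ge_a x0.
  by apply: derivableM; [exact: derivable_cst|exact: dpow].
- by apply: LR => x; exact: dpow.
- by move=> x /gt_a x0; rewrite powR_derive1// in_itv/= x0.
- by apply: derivable_within_continuous => x _; exact: ex_derive.
- by apply: LR => x _; exact: dexp.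
- move=> x _; rewrite derive1E.
  have h : is_derive x 1 (fun t : R => - expR (- t)) (expR (- x)).
    by apply: is_derive_eq; rewrite mulrN1 opprK.
  exact: derive_val.
Qed.

(* For s < 1 the integrand is unbounded at 0, so one integrates by parts on
   [1/(n+2), n+2] and lets n tend to infinity. *)
Lemma gamma_integralS s : 0 < s ->
  (gamma_integral (s + 1) = s%:E * gamma_integral s)%E.
Proof.
(* Starting from n+2 makes the endpoints distinct already at n = 0, as integration by parts requires
   a < b. *)
move=> s0; pose I n : set R := `[n.+2%:R^-1, n.+2%:R]%classic.
have cupI : \bigcup_n I n = `]0, +oo[%classic.
  apply/seteqP; split=> [t [n _]|t]; rewrite /I /= !in_itv/= ?andbT.
    by move=> /andP[+ _]; apply: lt_le_trans; rewrite invr_gt0.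
  move=> t0; have ht := truncnS_gt t; have hti := truncnS_gt t^-1.
  exists (maxn (Num.truncn t) (Num.truncn t^-1)) => //=; rewrite in_itv/=.
  rewrite -[t in _ <= t <= _]invrK lef_pV2 ?posrE ?invr_gt0//.
  apply/andP; split.
    by apply: (le_trans (ltW hti)); rewrite ler_nat ltnS leqW ?leq_maxr.
  by rewrite invrK; apply: (le_trans (ltW ht)); rewrite ler_nat ltnS leqW ?leq_maxl.
have ndI : nondecreasing_seq I.
  move=> m n mn; rewrite subsetEset; apply: subset_itv; rewrite bnd_simp.
    by rewrite lef_pV2 ?posrE// ler_nat.
  by rewrite ler_nat.
(* Monotone convergence for a nonnegative integrand: an infinite limit is allowed. *)
have cvgI r : (\int[mu]_(t in I n) (gamma_integrand r t)%:E)%E @[n --> \oo] -->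
    gamma_integral r.
  rewrite /gamma_integral -cupI; apply: ge0_nondecreasing_set_cvg_integral => //.
  - by move=> n; exact: measurable_itv.
  - by move=> n; apply/measurable_EFinP; exact: measurable_gamma_integrand.
  - by move=> n x _; rewrite lee_fin gamma_integrand_ge0.
pose B n : R := - (powR n.+1%:R s * expR (- n.+1%:R)) +
  powR n.+1%:R^-1 s * expR (- n.+1%:R^-1).
have B0 : B n @[n --> \oo] --> (- 0 + 0 : R).
  apply: cvgD; last exact: cvg_powR_inv_mul_expRN.
  by apply: cvgN; exact: cvg_powR_mul_expRN.
have cvgB : (B n.+1)%:E @[n --> \oo] --> 0%E.
  apply: cvg_EFin; first exact: nearW.
  by move: B0; rewrite oppr0 addr0 -(cvg_shiftS B).
have cvgS : (\int[mu]_(t in I n) (gamma_integrand (s + 1) t)%:E)%E @[n --> \oo] -->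
    (0 + s%:E * gamma_integral s)%E.
  rewrite (_ : (fun n => _) = (fun n => (B n.+1)%:E +
      s%:E * \int[mu]_(t in I n) (gamma_integrand s t)%:E)%E); last first.
    apply/funext => n; apply: gamma_integrand_by_parts; first by rewrite invr_gt0.
    by rewrite (@lt_trans _ _ 1)// ?invf_lt1// ltr1n.
  apply: cvgeD => //.
  by apply: cvgeZl => //; exact: cvgI.
by rewrite -[RHS]add0e; exact: cvg_unique (cvgI (s + 1)) cvgS.
Qed.

(** The integrand is dominated by (C + 1) exp(- t/2), written as a multiple of the exponential
    density of rate 1/2. C serves t >= 1; the extra 1 serves t < 1, where t^(s-1) <= 1 because s >=
    1. *)
Lemma gamma_integral_fin_num_ge1 s : 1 <= s -> gamma_integral s \is a fin_num.
Proof.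
move=> s1; have [C C0 hC] := powR_le_expR_half (s - 1).
have ifin : mu.-integrable setT (fun t => ((C + 1) * 2)%:E * (exponential_pdf 2^-1 t)%:E)%E.
  apply: (integrableZl measurableT ((C + 1) * 2)).
  exact: integrable_exponential_pdf.
apply: integrable_fin_num => //.
apply: (le_integrable _ _ _ (integrableS measurableT _ _ ifin)) => //.
- by apply/measurable_EFinP; exact: measurable_gamma_integrand.
move=> t; rewrite /= in_itv/= andbT => t0.
rewrite lee_fin ger0_norm ?gamma_integrand_ge0//; apply: le_trans (ler_norm _).
rewrite /gamma_integrand exponential_pdfE; last exact: ltW.
have -> : expR (- t) = expR (- 2^-1 * t) * expR (- (t / 2)).
  by rewrite -expRD; congr expR; lra.
rewrite mulrA [_ * (_ * _)]mulrA -[_ * 2 * _]mulrA mulfV// mulr1.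
rewrite mulrAC ler_wpM2r ?expR_ge0//.
rewrite expRN ler_pdivrMr ?expR_gt0//.
have [t1|t1] := leP 1 t.
  by apply: le_trans (hC _ t1) _; rewrite ler_wpM2r ?expR_ge0// lerDl.
have h1 : powR t (s - 1) <= 1.
  rewrite [leRHS](_ : _ = 1 `^ (s - 1)); last by rewrite powR1.
  apply: ge0_ler_powR; rewrite ?nnegrE ?subr_ge0// ltW//.
have : 1 <= expR (t / 2) by rewrite -expR0 ler_expR divr_ge0// ltW.
nra.
Qed.

(** The functional equation transfers finiteness from s+1 >= 1 down to s: an infinite value at s,
    multiplied by s > 0, would be infinite at s+1. *)
Lemma gamma_integral_fin_num s : 0 < s -> gamma_integral s \is a fin_num.
Proof.
move=> s0.
have : gamma_integral (s + 1) \is a fin_num by rewrite gamma_integral_fin_num_ge1// lerDr ltW.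
rewrite gamma_integralS//.
have : (0 <= gamma_integral s)%E.
  by apply: integral_ge0 => t _; rewrite lee_fin gamma_integrand_ge0.
by case: (gamma_integral s) => //; rewrite gt0_muley ?lte_fin.
Qed.

(** On [1, 2] the integrand is at least exp(-2) / 2, since t^(s-1) >= t^(-1) >= 1/2 and exp(- t) >=
    exp(-2). *)
Lemma gamma_integral_gt0 s : 0 < s -> (0 < gamma_integral s)%E.
Proof.
move=> s0.
have e0 : 0 < 2^-1 * expR (- 2 : R) by rewrite mulr_gt0 ?expR_gt0.
apply: (@lt_le_trans _ _ (\int[mu]_(t in `[1%R, 2%R]) (2^-1 * expR (- 2 : R))%:E)%E).
  rewrite integral_cst//= lebesgue_measure_itv/= lte_fin ltr1n -EFinD.
  by rewrite -EFinM lte_fin mulr_gt0// subr_gt0 ltr1n.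
apply: (@le_trans _ _ (\int[mu]_(t in `[1%R, 2%R]) (gamma_integrand s t)%:E)%E).
  apply: ge0_le_integral => //.
  - by apply/measurable_EFinP; exact: measurable_gamma_integrand.
  move=> t; rewrite /= in_itv/= => /andP[t1 t2]; rewrite lee_fin.
  have t0 : 0 < t by rewrite (lt_le_trans _ t1).
  apply: ler_pM; rewrite ?expR_ge0 ?ler_expR ?lerN2//.
  apply: (@le_trans _ _ (t `^ (-1))); last first.
    by rewrite ler_powR// lerBrDl addrN ltW.
  rewrite powR_inv1; last exact: ltW.
  by rewrite lef_pV2 ?posrE.
apply: ge0_subset_integral => //.
- by apply/measurable_EFinP; exact: measurable_gamma_integrand.
- by move=> t _; rewrite lee_fin gamma_integrand_ge0.
by move=> t; rewrite /= !in_itv/= => /andP[t1 _]; rewrite andbT (lt_le_trans _ t1).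
Qed.

Lemma Gamma_gt0 s : 0 < s -> 0 < Gamma s.
Proof.
move=> s0; apply: fine_gt0; rewrite [X in (_ < X)%E]/=.
by rewrite gamma_integral_gt0//= ltey_eq gamma_integral_fin_num.
Qed.

Lemma GammaS s : 0 < s -> Gamma (s + 1) = s * Gamma s.
Proof.
move=> s0; rewrite [LHS](_ : _ = fine (gamma_integral (s + 1)))//.
by rewrite gamma_integralS// fineM// gamma_integral_fin_num.
Qed.

End GammaFunction.

(** * The CK extension *)

Section CK_theory.
Context {R : realType} {m : nat} (nu : 'I_m.+1 -> R).
Hypothesis nu_gt0 : 0 < nu ord_max.

Definition CK_coef j : R :=
  Gamma (2 * nu ord_max) / (j`!%:R * Gamma (j%:R + 2 * nu ord_max)).

Lemma CKE k p : CK k nu p =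
  \sum_(j < k.+1) CK_coef j *:
    iter j (fun q => - ('X_ord_max * Lminus m nu q)) (mwiden p).
Proof. by rewrite /CK scaler_sumr; apply: eq_bigr => j _; rewrite scalerA. Qed.

Let nu2_gt0 : 0 < 2 * nu ord_max. Proof. exact: mulr_gt0. Qed.

Lemma CK_coef0 : CK_coef 0 = 1.
Proof. by rewrite /CK_coef fact0 mul1r add0r mulfV// gt_eqF// Gamma_gt0. Qed.

(** This is [GammaS] at j + 2 nu_n combined with (j+1)! = (j+1) j!; positivity of [Gamma] permits
    clearing denominators. *)
Lemma CK_coefS j :
  CK_coef j.+1 * (j.+1%:R * (j%:R + 2 * nu ord_max)) = CK_coef j.
Proof.
have s_gt0 : 0 < j%:R + 2 * nu ord_max by rewrite ltr_wpDl.
rewrite /CK_coef factS natrM -[j.+1%:R]natr1 addrAC GammaS//.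
have := Gamma_gt0 s_gt0; have : 0 < j`!%:R :> R by rewrite ltr0n fact_gt0.
have : 0 < j%:R + 1 :> R by rewrite ltr_wpDl.
move: s_gt0; set a := _ + 2 * _; set b := j%:R + 1; set c := j`!%:R; set d := Gamma a.
by move=> a0 b0 c0 d0; field; rewrite !gt_eqF.
Qed.

Lemma CK_linear k : linear (CK k nu).
Proof.
move=> a p q; rewrite !CKE mwidenD mwidenZ.
rewrite [X in _ = X + _]scaler_sumr -[RHS]big_split/=; apply: eq_bigr => j _.
rewrite [in RHS](scalerA a) (mulrC a) -(scalerA (CK_coef j)) -scalerDr; congr (_ *: _).
elim: (nat_of_ord j) => //= i ->.
by rewrite linearP/= mulrDr -scalerAr opprD scalerN.
Qed.

Lemma HBG_CK k p : p \is k.-homog -> HBG k nu (CK k nu p).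
Proof.
move=> hp; have hwp := dhomog_mwiden hp; rewrite CKE; split.
  exact: dhomog_CK_series.
apply: Lminus_CK_series; [exact: CK_coefS|exact: mderiv_mwiden|].
exact: iter_Lminus_dhomog hwp.
Qed.

Lemma mcoeff_CK k p (l : 'X_{1..m}) : (CK k nu p)@_(mnmwiden l) = p@_l.
Proof.
by rewrite CKE mcoeff_CK_series ?mnmwiden_ordmax// CK_coef0 mul1r mwiden_mnmwiden.
Qed.

(** The coefficients of the image at monomials free of x_n recover p. *)
Lemma CK_inj k : injective (CK k nu).
Proof. by move=> p q pq; apply/mpolyP => l; rewrite -(mcoeff_CK k p) pq mcoeff_CK. Qed.

(** The preimage p is q at x_n = 0. Then [CK k nu p - q] lies in the kernel and vanishes at x_n = 0,
    so [Lminus_ker_eq0] makes it zero. *)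
Lemma CK_onto k q : HBG k nu q -> exists2 p, p \is k.-homog & CK k nu p = q.
Proof.
move=> [hq Lq]; have [p hp pE] := dhomog_restrict hq; exists p => //.
have [_ LCK] := HBG_CK hp.
apply/eqP; rewrite -subr_eq0; apply/eqP.
apply: (Lminus_ker_eq0 nu_gt0) => [|l l0].
  by rewrite linearB/= LCK Lq subr0.
by rewrite (mnmwiden_narrow l0) mcoeffB mcoeff_CK pE subrr.
Qed.

End CK_theory.

Unset Implicit Arguments.

(* n = m.+1, so n >= 2 iff 1 <= m. *)
Theorem theorem4p2 (R : realType) (m k : nat) (hm : (1 <= m)%N)
    (nu : 'I_m.+1 -> R) (hnu : forall i, 0 < nu i) :
  (forall (a : R) (p q : {mpoly R[m]}),
      CK k nu (a *: p + q) = a *: CK k nu p + CK k nu q) /\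
  (forall p : {mpoly R[m]}, p \is k.-homog -> HBG k nu (CK k nu p)) /\
  (forall p q : {mpoly R[m]}, p \is k.-homog -> q \is k.-homog ->
      CK k nu p = CK k nu q -> p = q) /\
  (forall q : {mpoly R[m.+1]}, HBG k nu q ->
      exists2 p : {mpoly R[m]}, p \is k.-homog & CK k nu p = q).
Proof.
have nu_gt0 := hnu ord_max.
split; first exact: CK_linear.
split; first by move=> p; exact: HBG_CK.
split; first by move=> p q _ _; exact: CK_inj.
by move=> q; exact: CK_onto.
Qed.
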